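(* Assume that the functions $f(x)=Ax+\sum_{p=2}^{\ell}F_px^{\otimes p}$ and $g(x)=B+\sum_{p=1}^{\ell}G_p(x^{\otimes p}\otimes I_m)$ in the dynamics $\dot x=f(x)+g(x)u$, and the state and input penalties in the cost $$J(x_0,u)=\frac12\int_0^\infty\Big(x^\top Qx+u^\top Ru+\sum_{p=3}^{\lambda}q_p^\top x^{\otimes p}\Big)dt,$$ are analytic, and that a stabilizing solution exists to the linear-quadratic regulator problem associated with the linearized dynamics $\dot x=Ax+Bu$. Let $V_2$ be the corresponding symmetric positive semidefinite solution of the algebraic Riccati equation $0=A^\top V_2+V_2A-V_2BR^{-1}B^\top V_2+Q$, and put $v_2=\mathrm{vec}[V_2]$. Then, for each $k$ with $3\le k\le d$, the linear system $$\begin{aligned}\mathcal{L}_k\big(A-BR^{-1}B^\top V_2\big)^\top\tilde v_k={}&-\sum_{\substack{i,p\ge2\\ i+p=k+1}}\mathcal{L}_i(F_p)^\top v_i-q_k+\frac14\sum_{\substack{i,j>2\\ i+j=k+2}}ij\,\mathrm{vec}\big[V_i^\top BR^{-1}B^\top V_j\big]\\&+\frac14\sum_{o=1}^{2\ell}\ \sum_{\substack{p,q\ge0\\ p+q=o}}\ \sum_{\substack{i,j\ge2\\ i+j=k-o+2}}ij\,\mathrm{vec}\Big[\big(I_{n^p}\otimes\mathrm{vec}[I_m]^\top\big)\Big(\mathrm{vec}[G_q^\top V_j]^\top\otimes\big(G_p^\top V_i\otimes R^{-1}\big)\Big)\\&\qquad\qquad\times\big(I_{n^{j-1}}\otimes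 S_{n^{i-1}\times n^qm}\otimes I_m\big)\big(I_{n^{k-p}}\otimes\mathrm{vec}[I_m]\big)\Big]\end{aligned}$$ for the value function coefficient $v_k$ (where $v_k$ is the symmetrization of $\tilde v_k$, and the systems are solved successively for $k=3,\dots,d$, the right-hand side involving only $v_2,\dots,v_{k-1}$) has a unique solution.
   Context: Setting. $n,m,\ell\ge1$, $d\ge2$ are integers and $\lambda$ is an integer; $x(t)\in\mathbb{R}^n$ is the state and $u(t)\in\mathbb{R}^m$ the input. $A\in\mathbb{R}^{n\times n}$, $F_p\in\mathbb{R}^{n\times n^p}$ ($2\le p\le\ell$), $B\in\mathbb{R}^{n\times m}$, $G_p\in\mathbb{R}^{n\times mn^p}$ ($1\le p\le\ell$), $Q\in\mathbb{R}^{n\times n}$ symmetric with $Q\succeq0$, $R\in\mathbb{R}^{m\times m}$ symmetric with $R\succ0$, $q_p\in\mathbb{R}^{n^p}$ ($3\le p\le\lambda$). Conventions: $G_0:=B$; $F_p:=0$ and $G_p:=0$ for $p>\ell$; $q_k:=0$ for $k>\lambda$. The state penalty $x^\top Qx+\sum_{p=3}^{\lambda}q_p^\top x^{\otimes p}$ is of the form $x^\top\mathcal{Q}(x)x$ with $\mathcal{Q}(x)$ a symmetric positive semidefinite matrix-valued function. The linear-quadratic regulator (LQR) problem for the linearized dynamics is to minimize $\frac12\int_0^\infty(x^\top Qx+u^\top Ru)\,dt$ subject to $\dot x=Ax+Bu$. That it has a stabilizing solution means: for every initial state the minimum is attained by the feedback $u=-R^{-1}B^\top V_2x$, where $V_2$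 is the symmetric positive semidefinite solution of the algebraic Riccati equation $0=A^\top V_2+V_2A-V_2BR^{-1}B^\top V_2+Q$, and all eigenvalues of $A-BR^{-1}B^\top V_2$ have negative real part. Notation. $\otimes$ is the Kronecker product of matrices, $x^{\otimes k}=x\otimes\cdots\otimes x\in\mathbb{R}^{n^k}$ ($k$ factors), $I_p$ is the $p\times p$ identity, and $\mathrm{vec}[\cdot]$ stacks the columns of a matrix into one column vector. For $M\in\mathbb{R}^{p\times q}$ the $k$-way Lyapunov matrix is $$\mathcal{L}_k(M):=\sum_{i=1}^kI_p\otimes\cdots\otimes I_p\otimes M\otimes I_p\otimes\cdots\otimes I_p\in\mathbb{R}^{p^k\times p^{k-1}q}\quad(k\text{ factors, }M\text{ in the }i\text{th position}).$$ The perfect shuffle matrix $S_{q\times p}$ is the $pq\times pq$ permutation matrix such that $\mathrm{vec}[M^\top]=S_{q\times p}\mathrm{vec}[M]$ for all $M\in\mathbb{R}^{p\times q}$. For $v_i\in\mathbb{R}^{n^i}$, $V_i\in\mathbb{R}^{n\times n^{i-1}}$ denotes the matrix with $\mathrm{vec}[V_i]=v_i$. The symmetrization of $\tilde v\in\mathbb{R}^{n^k}$ is the vector $v\in\mathbb{R}^{n^k}$ determined by $v^\top(a_1\otimes\cdots\otimes a_k)=\frac1{k!}\sum_\pi\tilde v^\top(a_{\pi(1)}\otimes\cdots\otimes a_{\pi(k)})$ for all $a_1,\dots,a_k\in\mathbb{R}^n$, the sum running over all permutations $\pi$ of $\{1,\dots,k\}$. *)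

(* Defs.v *)
From HB Require Import structures.
From mathcomp Require Import all_boot all_order all_algebra all_fingroup.
From mathcomp Require Import all_classical all_reals all_analysis.
From mathcomp Require Import zify.
From mathcomp.real_closed Require Import mxtens complex.

Set Implicit Arguments.
Unset Strict Implicit.
Unset Printing Implicit Defensive.

Import Order.TTheory GRing.Theory Num.Theory.
Import numFieldNormedType.Exports.

Local Open Scope classical_set_scope.
Local Open Scope ring_scope.

Notation "A *t B" := (tensmx A B)
  (at level 40, left associativity, format "A  *t  B") : ring_scope.

(* Change of dimensions along an equality of naturals that holds only under
   the index constraints of a sum.  It is the zero matrix when the dimensions
   differ; the facts named [dim_...] show that this never happens at the places
   where [recast] is used, and there it is [castmx] (lemma [recastE]). *)
Definition recast {R : realType} {a b c d : nat} (M : 'M[R]_(a, b)) :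
  'M[R]_(c, d) := conform_mx 0 M.

Fact recastE (R : realType) (a b c d : nat) (M : 'M[R]_(a, b))
  (eac : a = c) (ebd : b = d) : recast M = castmx (eac, ebd) M.
Proof. by case: c / eac; case: d / ebd; rewrite /recast conform_mx_id castmx_id. Qed.

(* [mxtens_index (j, i)] has value [j * a + i]: the columns of M are stacked. *)
Definition vec {R : realType} {a b : nat} (M : 'M[R]_(a, b)) : 'cV[R]_(b * a) :=
  \col_s M (mxtens_unindex s).2 (mxtens_unindex s).1.

Definition unvec {R : realType} {a b : nat} (v : 'cV[R]_(b * a)) :
  'M[R]_(a, b) := \matrix_(i, j) v (mxtens_index (j, i)) 0.

Fact unvecK (R : realType) (a b : nat) :
  cancel (@unvec R a b) (@vec R a b).
Proof.
move=> v; apply/colP => s; case: (mxtens_indexP s) => j i.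
by rewrite !mxE mxtens_indexK.
Qed.

(* [perfect_shuffle q p] is the matrix S_{q x p}; its row and column indices
   both range over pq elements, read as pairs in the two possible orders. *)
Definition perfect_shuffle (R : realType) (q p : nat) : 'M[R]_(p * q, q * p) :=
  \matrix_(s, t) (mxtens_unindex s == ((mxtens_unindex t).2, (mxtens_unindex t).1))%:R.

Fact perfect_shuffleP (R : realType) (p q : nat) (M : 'M[R]_(p, q)) :
  vec M^T = perfect_shuffle R q p *m vec M.
Proof.
apply/colP => s; case: (mxtens_indexP s) => i j.
rewrite !mxE mxtens_indexK /= (bigD1 (mxtens_index (j, i))) //= !mxE.
rewrite !mxtens_indexK eqxx mul1r big1 ?addr0 // => t.
case: (mxtens_indexP t) => j' i' ne; rewrite !mxE !mxtens_indexK /= xpair_eqE.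
case: eqP => [ei|]; case: eqP => [ej|]; rewrite ?mul0r //.
by case/eqP: ne; rewrite ei ej.
Qed.

(* a_1 ⊗ ... ⊗ a_k, the family being indexed from 0 *)
Fixpoint kron_family {R : realType} {n k : nat} :
    ('I_k -> 'cV[R]_n) -> 'cV[R]_(n ^ k) :=
  match k with
  | 0 => fun=> 1%:M
  | k'.+1 => fun a => castmx (esym (expnS n k'), erefl)
                       (a ord0 *t kron_family (fun i => a (lift ord0 i)))
  end.

Definition kron_pow {R : realType} {n : nat} (k : nat) (x : 'cV[R]_n) :
  'cV[R]_(n ^ k) := kron_family (fun _ : 'I_k => x).

Fact dim_lyap_row (p k : nat) (i : 'I_k) : (p ^ i * p * p ^ (k.-1 - i) = p ^ k)%N.
Proof.
case: k i => [[]|k] i //=; rewrite -expnSr -expnD.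
by congr (_ ^ _)%N; have := ltn_ord i; lia.
Qed.

Fact dim_lyap_col (p q k : nat) (i : 'I_k) :
  (p ^ i * q * p ^ (k.-1 - i) = p ^ k.-1 * q)%N.
Proof. by case: k i => [[]|k] i //=; rewrite mulnAC -expnD subnKC // -ltnS. Qed.

(* The summand of index i : 'I_k has M in position i + 1; the identity factors
   on either side of M are merged into one identity matrix. *)
Definition lyapunov {R : realType} {p q : nat} (k : nat) (M : 'M[R]_(p, q)) :
  'M[R]_(p ^ k, p ^ k.-1 * q) :=
  \sum_(i < k) castmx (dim_lyap_row p i, dim_lyap_col p q i)
    ((1%:M : 'M[R]_(p ^ i)) *t M *t (1%:M : 'M[R]_(p ^ (k.-1 - i)))).

Definition is_symmetrization {R : realType} {n k : nat} (vt v : 'cV[R]_(n ^ k)) :=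
  forall a : 'I_k -> 'cV[R]_n,
    (v^T *m kron_family a) 0 0 =
    (k`!%:R)^-1 * \sum_(s : 'S_k) (vt^T *m kron_family (fun i => a (s i))) 0 0.

Definition symmetric_mx {R : realType} {n : nat} (M : 'M[R]_n) := M^T = M.

Definition possemidef {R : realType} {n : nat} (M : 'M[R]_n) :=
  forall x : 'cV[R]_n, 0 <= (x^T *m M *m x) 0 0.

Definition posdef {R : realType} {n : nat} (M : 'M[R]_n) :=
  forall x : 'cV[R]_n, x != 0 -> 0 < (x^T *m M *m x) 0 0.

Definition hurwitz {R : realType} {n : nat} (M : 'M[R]_n) :=
  forall z : R[i], eigenvalue (map_mx (real_complex R) M) z -> complex.Re z < 0.

(* Around each point, phi is the sum of a power series that converges
   absolutely (monomial by monomial) on a cube; the part of degree p of the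
   series is c_p^T h^{⊗p}. *)
Definition analytic {R : realType} {n : nat} (phi : 'cV[R]_n -> R) :=
  forall x0 : 'cV[R]_n, exists (c : forall p, 'cV[R]_(n ^ p)) (r : R), 0 < r /\
    forall h : 'cV[R]_n, (forall i, `|h i 0| < r) ->
      cvgn (series (fun p => ((map_mx Num.norm (c p))^T *m
                               kron_pow p (map_mx Num.norm h)) 0 0)) /\
      series (fun p => ((c p)^T *m kron_pow p h) 0 0) @ \oo --> phi (x0 + h).

Definition analytic_mx {R : realType} {n a b : nat} (phi : 'cV[R]_n -> 'M[R]_(a, b)) :=
  forall i j, analytic (fun x => phi x i j).

Definition drift {R : realType} {n : nat} (ell : nat) (A : 'M[R]_n)
    (F : forall p, 'M[R]_(n, n ^ p)) (x : 'cV[R]_n) : 'cV[R]_n :=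
  A *m x + \sum_(2 <= p < ell.+1) F p *m kron_pow p x.

Definition input_map {R : realType} {n m : nat} (ell : nat) (B : 'M[R]_(n, m))
    (G : forall p, 'M[R]_(n, n ^ p * m)) (x : 'cV[R]_n) : 'M[R]_(n, m) :=
  B + \sum_(1 <= p < ell.+1)
        castmx (erefl, mul1n m) (G p *m (kron_pow p x *t (1%:M : 'M[R]_m))).

(* lam is an integer, possibly negative; the sum is over 3 <= p <= lam. *)
Definition state_penalty {R : realType} {n : nat} (lam : int) (Q : 'M[R]_n)
    (q : forall p, 'cV[R]_(n ^ p)) (x : 'cV[R]_n) : R :=
  (x^T *m Q *m x) 0 0 +
  \sum_(3 <= p < `|lam|%N.+1 | (p%:Z <= lam)%R) ((q p)^T *m kron_pow p x) 0 0.

Definition input_penalty {R : realType} {m : nat} (Rm : 'M[R]_m) (u : 'cV[R]_m) : R :=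
  (u^T *m Rm *m u) 0 0.

(* Locally integrable inputs and Carathéodory solutions on [0, +oo[ of
   x' = A x + B u, x(0) = x0. *)
Definition lqr_trajectory {R : realType} {n m : nat} (A : 'M[R]_n) (B : 'M[R]_(n, m))
    (x0 : 'cV[R]_n) (x : R -> 'cV[R]_n) (u : R -> 'cV[R]_m) :=
  forall T : R, 0 <= T ->
    (forall i, lebesgue_measure.-integrable `[0, T] (fun t => (u t i 0)%:E)) /\
    (forall i,
       lebesgue_measure.-integrable `[0, T] (fun t => ((A *m x t + B *m u t) i 0)%:E) /\
       x T i 0 = x0 i 0 +
         Rintegral lebesgue_measure `[0, T] (fun t => (A *m x t + B *m u t) i 0)).

Definition lqr_cost {R : realType} {n m : nat} (Q : 'M[R]_n) (Rm : 'M[R]_m)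
    (x : R -> 'cV[R]_n) (u : R -> 'cV[R]_m) : \bar R :=
  ((2^-1)%:E * \int[lebesgue_measure]_(t in `[0%R, +oo[)
     (((x t)^T *m Q *m x t) 0 0 + ((u t)^T *m Rm *m u t) 0 0)%R%:E)%E.

Definition riccati {R : realType} {n m : nat} (A : 'M[R]_n) (B : 'M[R]_(n, m))
    (Q : 'M[R]_n) (Rm : 'M[R]_m) (V2 : 'M[R]_n) :=
  0 = A^T *m V2 + V2 *m A - V2 *m B *m invmx Rm *m B^T *m V2 + Q.

Definition closed_loop {R : realType} {n m : nat} (A : 'M[R]_n) (B : 'M[R]_(n, m))
    (Rm : 'M[R]_m) (V2 : 'M[R]_n) : 'M[R]_n :=
  A - B *m invmx Rm *m B^T *m V2.

Definition lqr_stabilizing_solution {R : realType} {n m : nat} (A : 'M[R]_n)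
    (B : 'M[R]_(n, m)) (Q : 'M[R]_n) (Rm : 'M[R]_m) (V2 : 'M[R]_n) :=
  [/\ symmetric_mx V2, possemidef V2, riccati A B Q Rm V2,
      hurwitz (closed_loop A B Rm V2) &
      forall x0 : 'cV[R]_n, exists (x : R -> 'cV[R]_n),
        let u := fun t => - (invmx Rm *m B^T *m V2 *m x t) in
        lqr_trajectory A B x0 x u /\
        forall x' u', lqr_trajectory A B x0 x' u' ->
          (lqr_cost Q Rm x u <= lqr_cost Q Rm x' u')%E].

(* Conventions: F_p = 0 and G_p = 0 for p > ell, G_0 = B, q_p = 0 for p > lam. *)
Definition F_ext {R : realType} {n : nat} (ell : nat)
    (F : forall p, 'M[R]_(n, n ^ p)) (p : nat) : 'M[R]_(n, n ^ p) :=
  if (p <= ell)%N then F p else 0.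

Definition G_ext {R : realType} {n m : nat} (ell : nat) (B : 'M[R]_(n, m))
    (G : forall p, 'M[R]_(n, n ^ p * m)) (p : nat) : 'M[R]_(n, n ^ p * m) :=
  match p with
  | 0 => castmx (erefl, esym (mul1n m)) B
  | p'.+1 => if (p'.+1 <= ell)%N then G p'.+1 else 0
  end.

Definition q_ext {R : realType} {n : nat} (lam : int)
    (q : forall p, 'cV[R]_(n ^ p)) (p : nat) : 'cV[R]_(n ^ p) :=
  if p%:Z <= lam then q p else 0.

Fact dim_coef_mx (n i : nat) : (0 < i)%N -> (n ^ i = n ^ i.-1 * n)%N.
Proof. by case: i => // i _; rewrite expnSr. Qed.

(* V_i, the n x n^(i-1) matrix such that vec V_i = v_i, for i >= 1 *)
Definition coef_mx {R : realType} {n i : nat} (v : 'cV[R]_(n ^ i)) :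
  'M[R]_(n, n ^ i.-1) := unvec (recast v).

Fact coef_mxP (R : realType) (n i : nat) (v : 'cV[R]_(n ^ i)) :
  (0 < i)%N -> recast (vec (coef_mx v)) = v.
Proof.
move=> i0; rewrite /coef_mx unvecK (recastE v (dim_coef_mx n i0) erefl).
by rewrite (recastE _ (esym (dim_coef_mx n i0)) erefl) castmx_comp castmx_id.
Qed.

Fact dim_drift_term (n k i p : nat) :
  (2 <= i)%N -> (i + p = k.+1)%N -> (n ^ i.-1 * n ^ p = n ^ k)%N.
Proof. by move=> i2 e; rewrite -expnD; congr (_ ^ _)%N; lia.
Qed.

Definition drift_term {R : realType} {n : nat} (ell : nat)
    (F : forall p, 'M[R]_(n, n ^ p)) (v : forall i, 'cV[R]_(n ^ i)) (k : nat) :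
  'cV[R]_(n ^ k) :=
  \sum_(2 <= i < k.+1) \sum_(2 <= p < k.+1 | (i + p == k + 1)%N)
    recast ((lyapunov i (F_ext ell F p))^T *m v i).

Fact dim_input_term (n k i j : nat) :
  (2 < i)%N -> (2 < j)%N -> (i + j = k + 2)%N -> (n ^ j.-1 * n ^ i.-1 = n ^ k)%N.
Proof.
by move=> i3 j3 e; rewrite -expnD; congr (_ ^ _)%N; lia.
Qed.

Definition input_term {R : realType} {n m : nat} (B : 'M[R]_(n, m)) (Rm : 'M[R]_m)
    (v : forall i, 'cV[R]_(n ^ i)) (k : nat) : 'cV[R]_(n ^ k) :=
  \sum_(3 <= i < k.+1) \sum_(3 <= j < k.+1 | (i + j == k + 2)%N)
    (i * j)%:R *: recast (vec
       ((coef_mx (v i))^T *m B *m invmx Rm *m B^T *m coef_mx (v j))).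

Fact dim_quad1 (N m : nat) : (N * (m * m) = 1 * (N * m * m))%N.
Proof. by rewrite mul1n mulnA. Qed.

Fact dim_quad2 (a b c m : nat) : (a * (b * c) * m = a * c * (b * m))%N.
Proof. by rewrite !mulnA; congr (_ * _)%N; rewrite mulnAC. Qed.

Fact dim_quad3 (a b c m : nat) : (a * (c * b) * m = a * c * (b * m))%N.
Proof. by rewrite !mulnA. Qed.

Fact dim_quad4 (n m k o p r i j : nat) :
  (p + r = o)%N -> (2 <= i)%N -> (2 <= j)%N -> (i + j + o = k + 2)%N ->
  (n ^ (k - p) * (m * m) = n ^ j.-1 * (n ^ r * m) * (n ^ i.-1 * m))%N.
Proof.
move=> epr i2 j2 e.
have -> : (k - p = j.-1 + r + i.-1)%N by lia.
by rewrite !expnD !mulnA; congr (_ * _)%N; rewrite mulnAC.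
Qed.

Fact dim_quad5 (n k o p r i j : nat) :
  (p + r = o)%N -> (2 <= i)%N -> (2 <= j)%N -> (i + j + o = k + 2)%N ->
  (n ^ (k - p) * 1 * (n ^ p * 1) = n ^ k)%N.
Proof.
by move=> epr i2 j2 e; rewrite !muln1 -expnD; congr (_ ^ _)%N; lia.
Qed.

(* The summation index q of the systems is named r here, and the weight matrix R
   is Rm. *)
Definition quad_mx {R : realType} {n m : nat} (ell : nat) (B : 'M[R]_(n, m))
    (G : forall p, 'M[R]_(n, n ^ p * m)) (Rm : 'M[R]_m)
    (v : forall i, 'cV[R]_(n ^ i)) (k p r i j : nat) :
  'M[R]_(n ^ p * 1, n ^ (k - p) * 1) :=
  castmx (erefl, dim_quad1 (n ^ p) m)
    ((1%:M : 'M[R]_(n ^ p)) *t (vec (1%:M : 'M[R]_m))^T)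
  *m ((vec ((G_ext ell B G r)^T *m coef_mx (v j)))^T
      *t (((G_ext ell B G p)^T *m coef_mx (v i)) *t invmx Rm))
  *m castmx (dim_quad3 (n ^ j.-1) (n ^ i.-1) (n ^ r * m) m,
             dim_quad2 (n ^ j.-1) (n ^ i.-1) (n ^ r * m) m)
       ((1%:M : 'M[R]_(n ^ j.-1)) *t perfect_shuffle R (n ^ i.-1) (n ^ r * m)
        *t (1%:M : 'M[R]_m))
  *m recast ((1%:M : 'M[R]_(n ^ (k - p))) *t vec (1%:M : 'M[R]_m)).

(* The constraint i + j = k - o + 2 is written without subtraction. *)
Definition quad_term {R : realType} {n m : nat} (ell : nat) (B : 'M[R]_(n, m))
    (G : forall p, 'M[R]_(n, n ^ p * m)) (Rm : 'M[R]_m)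
    (v : forall i, 'cV[R]_(n ^ i)) (k : nat) : 'cV[R]_(n ^ k) :=
  \sum_(1 <= o < (2 * ell).+1)
    \sum_(0 <= p < o.+1) \sum_(0 <= r < o.+1 | (p + r == o)%N)
      \sum_(2 <= i < k.+1) \sum_(2 <= j < k.+1 | (i + j + o == k + 2)%N)
        (i * j)%:R *: recast (vec (quad_mx ell B G Rm v k p r i j)).

Fact dim_lhs (n k : nat) : (0 < k)%N -> (n ^ k.-1 * n = n ^ k)%N.
Proof. by move=> k0; rewrite -dim_coef_mx. Qed.

(* The linear system of order k for vt, given the coefficients v; only v_i with
   2 <= i <= k - 1 occur. *)
Definition coef_system {R : realType} {n m : nat} (ell : nat) (lam : int)
    (A : 'M[R]_n) (F : forall p, 'M[R]_(n, n ^ p))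
    (B : 'M[R]_(n, m)) (G : forall p, 'M[R]_(n, n ^ p * m))
    (Rm : 'M[R]_m) (q : forall p, 'cV[R]_(n ^ p)) (V2 : 'M[R]_n)
    (v : forall i, 'cV[R]_(n ^ i)) (k : nat) (vt : 'cV[R]_(n ^ k)) :=
  recast ((lyapunov k (closed_loop A B Rm V2))^T *m vt) =
    - drift_term ell F v k - q_ext lam q k
    + 4^-1 *: input_term B Rm v k
    + 4^-1 *: quad_term ell B G Rm v k :> 'cV[R]_(n ^ k).

(* v_2 = vec V_2, and for 3 <= j < k the vectors vt_j and v_j have been obtained
   by solving the system of order j and symmetrizing. *)
Definition coefs_below {R : realType} {n m : nat} (ell : nat) (lam : int)
    (A : 'M[R]_n) (F : forall p, 'M[R]_(n, n ^ p))
    (B : 'M[R]_(n, m)) (G : forall p, 'M[R]_(n, n ^ p * m))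
    (Rm : 'M[R]_m) (q : forall p, 'cV[R]_(n ^ p)) (V2 : 'M[R]_n)
    (k : nat) (vt v : forall i, 'cV[R]_(n ^ i)) :=
  v 2%N = vec V2 /\
  forall j, (3 <= j < k)%N ->
    coef_system ell lam A F B G Rm q V2 v (vt j) /\ is_symmetrization (vt j) (v j).

(* Main.v *)
Require Import Defs.
From mathcomp Require Import all_boot all_order all_algebra all_fingroup.
From mathcomp Require Import all_classical all_reals all_analysis.
From mathcomp.real_closed Require Import mxtens complex.
Import Order.TTheory GRing.Theory Num.Theory.
Local Open Scope ring_scope.

(** The system of order k is a square linear system: its right-hand side does
not involve the unknown, so it has exactly one solution as soon as the k-way
Lyapunov matrix L_k(M) of the closed-loop matrix M = A - B R^-1 B^T V_2 is
invertible.

The eigenvalues of L_k(M) over the complex numbers are sums of k eigenvalues of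
M.  Indeed, up to the identification of R^(n * n^k) with R^(n^(k+1)),
  L_(k+1)(M) = M ⊗ I + I ⊗ L_k(M)
([sum_kron_factors]), and the two summands commute.  An eigenvalue of a sum of
two commuting matrices is a sum of one eigenvalue of each, because the
eigenspace of the sum is stable under the first matrix and so contains an
eigenvector common to both ([eigenvalue_comm_addmx]); and tensoring with an
identity matrix creates no new eigenvalue.  Induction on k gives
[eigenvalue_kron_sum].

A stabilizing solution of the regulator problem makes M Hurwitz.  A sum of
k > 0 complex numbers with negative real parts is not zero, hence 0 is not an
eigenvalue of L_k(M) ([hurwitz_kron_sum_unit]). *)

Lemma tensmxDl (R : pzRingType) (a b c e : nat) (M N : 'M[R]_(a, b)) (P : 'M[R]_(c, e)) :
  (M + N) *t P = M *t P + N *t P.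
Proof. by apply/matrixP => i j; rewrite !mxE mulrDl. Qed.

Lemma tensmxDr (R : pzRingType) (a b c e : nat) (P : 'M[R]_(a, b)) (M N : 'M[R]_(c, e)) :
  P *t (M + N) = P *t M + P *t N.
Proof. by apply/matrixP => i j; rewrite !mxE mulrDr. Qed.

Lemma tens_scalar_scalar (R : pzRingType) (a b : nat) (x y : R) :
  (x%:M : 'M[R]_a) *t (y%:M : 'M[R]_b) = (x * y)%:M.
Proof.
apply/matrixP => s t; case: (mxtens_indexP s) => i j; case: (mxtens_indexP t) => k l.
rewrite tensmxE !mxE (can_eq (@mxtens_indexK _ _)) xpair_eqE.
by case: (i == k); case: (j == l); rewrite ?mulr0 ?mul0r.
Qed.

Lemma tensmxA (R : pzRingType) (a b c d e f : nat)
    (M : 'M[R]_(a, b)) (N : 'M[R]_(c, d)) (P : 'M[R]_(e, f)) :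
  M *t N *t P = castmx (mulnA a c e, mulnA b d f) (M *t (N *t P)).
Proof.
have assoc (x y z : nat) (i : 'I_x) (j : 'I_y) (k : 'I_z) :
    cast_ord (esym (mulnA x y z)) (mxtens_index (mxtens_index (i, j), k)) =
      mxtens_index (i, mxtens_index (j, k)).
  by apply: val_inj; rewrite /= mulnDl mulnA addnA.
apply/matrixP => s t; rewrite castmxE.
case: (mxtens_indexP s) => sMN sP; case: (mxtens_indexP sMN) => sM sN.
case: (mxtens_indexP t) => tMN tP; case: (mxtens_indexP tMN) => tM tN.
by rewrite !assoc !tensmxE mulrA.
Qed.

(** If M - a is invertible, so is (M - a) ⊗ 1 = M ⊗ 1 - a. *)
Lemma eigenvalue_tensmx1 (K : fieldType) (p q : nat) (M : 'M[K]_p) (a : K) :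
  eigenvalue (M *t (1%:M : 'M[K]_q)) a -> eigenvalue M a.
Proof.
apply: contraTT; rewrite /eigenvalue /eigenspace !negbK !kermx_eq0 !row_free_unit.
move=> unitMa.
have -> : M *t (1%:M : 'M[K]_q) - a%:M = (M - a%:M) *t 1%:M.
  rewrite -[a in LHS]mulr1 -tens_scalar_scalar [in RHS]tensmxDl; congr (_ + _).
  by apply/matrixP => i j; rewrite !mxE mulNr.
have: ((M - a%:M) *t (1%:M : 'M[K]_q)) *m (invmx (M - a%:M) *t 1%:M) = 1%:M.
  by rewrite tensmx_mul mulmxV // mulmx1 tens_scalar_scalar mulr1.
by case/mulmx1_unit.
Qed.

Lemma eigenvalue_1tensmx (K : fieldType) (p q : nat) (M : 'M[K]_q) (a : K) :
  eigenvalue ((1%:M : 'M[K]_p) *t M) a -> eigenvalue M a.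
Proof.
apply: contraTT; rewrite /eigenvalue /eigenspace !negbK !kermx_eq0 !row_free_unit.
move=> unitMa.
have -> : (1%:M : 'M[K]_p) *t M - a%:M = 1%:M *t (M - a%:M).
  rewrite -[a in LHS]mul1r -tens_scalar_scalar [in RHS]tensmxDr; congr (_ + _).
  by apply/matrixP => i j; rewrite !mxE mulrN.
have: ((1%:M : 'M[K]_p) *t (M - a%:M)) *m (1%:M *t invmx (M - a%:M)) = 1%:M.
  by rewrite tensmx_mul mulmxV // mulmx1 tens_scalar_scalar mulr1.
by case/mulmx1_unit.
Qed.

(** Over an algebraically closed field the restriction of S to the eigenspace of
S + T for z, which S preserves, has an eigenvector; T = (S + T) - S then acts on
it as a scalar too. *)
Lemma eigenvalue_comm_addmx (C : numClosedFieldType) (N : nat) (S T : 'M[C]_N) (z : C) :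
  S *m T = T *m S -> eigenvalue (S + T) z ->
  exists a b, [/\ eigenvalue S a, eigenvalue T b & z = a + b].
Proof.
move=> commST eig_z; pose E := eigenspace (S + T) z.
have stableES : stablemx E S.
  by apply: comm_mx_stable_eigenspace; rewrite /comm_mx mulmxDl mulmxDr commST.
have rankE : (0 < \rank E)%N by rewrite lt0n mxrank_eq0.
have [b /eigenvalueP[w /eigenspaceP wS w0]] :=
  eigenvalue_closed (conjmx (row_base E) S) rankE.
pose v := w *m row_base E.
have v0 : v != 0 by rewrite -mxrank_eq0 mxrankMfree ?row_base_free // mxrank_eq0.
have /eigenspaceP vS : (v <= eigenspace S b)%MS.
  by rewrite -sub_eigenspace_conjmx ?row_base_free ?stablemx_row_base.
have /eigenspaceP vST : (v <= E)%MS by rewrite -(eq_row_base E) submxMl.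
exists b, (z - b); split; last by rewrite addrC subrK.
  by apply/eigenvalueP; exists v.
apply/eigenvalueP; exists v => //.
by rewrite scalerBl -vST -vS mulmxDr addrC addKr.
Qed.

(** The k-way Lyapunov matrix of a square matrix, in a form suited to induction on
k and typed as a square matrix, so that eigenvalues make sense. *)
Fixpoint kron_sum {K : pzRingType} {n : nat} (k : nat) (M : 'M[K]_n) : 'M[K]_(n ^ k) :=
  match k with
  | 0 => 0
  | k'.+1 => castmx (esym (expnS n k'), esym (expnS n k'))
               (M *t (1%:M : 'M[K]_(n ^ k')) + (1%:M : 'M[K]_n) *t kron_sum k' M)
  end.

Lemma map_kron_sum (K L : pzRingType) (f : {rmorphism K -> L}) (n k : nat) (M : 'M[K]_n) :
  map_mx f (kron_sum k M) = kron_sum k (map_mx f M).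
Proof.
elim: k => [|k IHk] /=; first by rewrite map_mx0.
by rewrite map_castmx map_mxD !map_mxT !map_mx1 IHk.
Qed.

Lemma eigenvalue_castmx (K : fieldType) (p q : nat) (e : p = q) (M : 'M[K]_p) (a : K) :
  eigenvalue (castmx (e, e) M) a = eigenvalue M a.
Proof. by case: q / e; rewrite castmx_id. Qed.

Lemma eigenvalue_kron_sum (C : numClosedFieldType) (n k : nat) (M : 'M[C]_n) (z : C) :
  eigenvalue (kron_sum k M) z ->
  exists2 a : 'I_k -> C, forall i, eigenvalue M (a i) & z = \sum_i a i.
Proof.
elim: k z => [|k IHk] z /=.
  (* The only eigenvalue of the 1 x 1 zero matrix is 0, the empty sum. *)
  case/eigenvalueP => v; rewrite mulmx0 => /esym/eqP; rewrite scaler_eq0.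
  by case/orP => [/eqP-> _|->//]; exists (fun=> 0) => [[]|] //; rewrite big_ord0.
rewrite eigenvalue_castmx => /eigenvalue_comm_addmx[].
  by rewrite -tensmx_decr -tensmx_decl.
move=> a [b [/eigenvalue_tensmx1 eig_a /eigenvalue_1tensmx/IHk[c eig_c ->] ->]].
exists (fun i => if unlift ord0 i is Some j then c j else a).
  by move=> i; case: unliftP.
rewrite big_ord_recl unlift_none; congr (_ + _).
by apply: eq_bigr => i _; rewrite liftK.
Qed.

(** Were the real matrix singular, 0 would be an eigenvalue of its complexification,
that is, a sum of k > 0 numbers with negative real parts. *)
Lemma hurwitz_kron_sum_unit (R : realType) (n k : nat) (M : 'M[R]_n) :
  (0 < k)%N -> hurwitz M -> kron_sum k M \in unitmx.
Proof.
case: k => // k _ hM; rewrite -row_free_unit -kermx_eq0.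
have -> : kermx (kron_sum k.+1 M) = eigenspace (kron_sum k.+1 M) 0.
  by rewrite /eigenspace raddf0 subr0.
apply/negPn/negP => sing.
have: eigenvalue (map_mx (real_complex R) (kron_sum k.+1 M)) (real_complex R 0).
  by rewrite eigenvalue_map.
rewrite (map_kron_sum _ _ (real_complex R)) => /eigenvalue_kron_sum[a eig_a sum0].
have ReD : {morph (@complex.Re R) : x y / x + y} by case=> ? ? [].
suff: complex.Re (\sum_i a i) < 0 by rewrite -sum0 ltxx.
rewrite (big_morph _ ReD (erefl : complex.Re 0 = 0)) big_ord_recl.
rewrite ltr_wnDr ?hM //.
by apply: sumr_le0 => i _; apply/ltW/hM.
Qed.

Lemma castmx0 (K : nmodType) (a b a' b' : nat) (e : (a = a') * (b = b')) :
  castmx e (0 : 'M[K]_(a, b)) = 0.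
Proof. by case: e => ea eb; case: a' / ea; case: b' / eb. Qed.

Lemma castmxD (K : nmodType) (a b a' b' : nat) (e : (a = a') * (b = b')) :
  {morph (@castmx K a b a' b' e) : M N / M + N}.
Proof. by case: e => ea eb; case: a' / ea; case: b' / eb. Qed.

(** The summand of index 0 in L_(k+1)(M), where c = n^0, b = n^(k-0) and b' = n^k.
Not all of these equalities are conversions, so the dimensions are variables that
the proof can identify by case analysis; [cast_later_factor] is stated in the
same way for the same reason. *)
Lemma cast_first_factor (K : pzRingType) (p c b b' N : nat) (M : 'M[K]_p)
    (e1 : (c * p * b = N)%N) (ec : 1%N = c) (eb : b' = b) (e4 : (p * b' = N)%N) :
  castmx (e1, e1) ((1%:M : 'M[K]_c) *t M *t (1%:M : 'M[K]_b)) =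
  castmx (e4, e4) (M *t (1%:M : 'M[K]_b')).
Proof.
case: c / ec e1; case: b / eb => e1.
rewrite tensmxA tens_scalar1mx !castmx_comp.
by apply/matrixP => i j; rewrite !castmxE; congr (_ _ _); apply: val_inj.
Qed.

Lemma tens_castmxl (K : pzRingType) (a b a' b' c d : nat) (e : (a = a') * (b = b'))
    (M : 'M[K]_(a, b)) (N : 'M[K]_(c, d)) :
  castmx e M *t N = castmx (congr1 (muln^~ c) e.1, congr1 (muln^~ d) e.2) (M *t N).
Proof. by case: e => ea eb; case: a' / ea; case: b' / eb. Qed.

(** A summand of index i + 1 in L_(k+1)(M) is I ⊗ (summand of index i in L_k(M)):
here c = n^(i+1), a = n^i, and the leading identity splits as I_c = I_p ⊗ I_a. *)
Lemma cast_later_factor (K : pzRingType) (p a b b' c N N' : nat) (M : 'M[K]_p)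
    (e1 : (c * p * b = N)%N) (ec : (p * a = c)%N) (eb : b' = b)
    (e3 : (a * p * b' = N')%N) (e4 : (p * N' = N)%N) :
  castmx (e1, e1) ((1%:M : 'M[K]_c) *t M *t (1%:M : 'M[K]_b)) =
  castmx (e4, e4) ((1%:M : 'M[K]_p) *t
    castmx (e3, e3) ((1%:M : 'M[K]_a) *t M *t (1%:M : 'M[K]_b'))).
Proof.
case: c / ec e1; case: b / eb; case: N' / e3 e4 => e4; case: N / e4 => e1.
rewrite !castmx_id -[X in (X%:M *t M) *t _](mulr1 1) -tens_scalar_scalar.
rewrite (tensmxA _ _ _ _ _ _ _ _ _ M) tens_castmxl tensmxA !castmx_comp.
by apply/matrixP => i j; rewrite castmxE; congr (_ _ _); apply: val_inj.
Qed.

(** The left-hand side is the sum that defines the k-way Lyapunov matrix, its columns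
being counted by n^k instead of n^(k-1) * n. *)
Lemma sum_kron_factors (K : pzRingType) (n k : nat) (M : 'M[K]_n) :
  \sum_(i < k) castmx (dim_lyap_row n i, dim_lyap_row n i)
    ((1%:M : 'M[K]_(n ^ i)) *t M *t (1%:M : 'M[K]_(n ^ (k.-1 - i)))) = kron_sum k M.
Proof.
elim: k => [|k IHk] /=; first by rewrite big_ord0.
have first_exp : (n ^ k = n ^ (k - 0))%N by rewrite subn0.
have later_exp (i : 'I_k) : (n ^ (k.-1 - i) = n ^ (k - lift ord0 i))%N.
  by congr (_ ^ _)%N; rewrite lift0; case: k i {IHk first_exp} => [[]|].
(* The summand of index 0 is M ⊗ I; the others add up to I ⊗ L_k(M). *)
rewrite big_ord_recl castmxD; congr (_ + _).
  exact: cast_first_factor.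
rewrite -IHk (big_morph _ (tensmxDr _ _ _ _ _ _) (tensmx0 _)).
rewrite (big_morph _ (castmxD _ _ _ _ _ _) (castmx0 _ _ _ _ _ _)).
by apply: eq_bigr => i _; apply: cast_later_factor => //; rewrite -?expnS.
Qed.

Lemma lyapunov_kron_sum (R : realType) (n k : nat) (k0 : (0 < k)%N) (M : 'M[R]_n) :
  lyapunov k M = castmx (erefl, esym (dim_lhs n k0)) (kron_sum k M).
Proof.
rewrite -sum_kron_factors (big_morph _ (castmxD _ _ _ _ _ _) (castmx0 _ _ _ _ _ _)).
apply: eq_bigr => i _; rewrite castmx_comp.
by congr (castmx (_, _) _); apply: eq_irrelevance.
Qed.

Lemma hurwitz_lyapunov_system (R : realType) (n k : nat) (M : 'M[R]_n)
    (rhs : 'cV[R]_(n ^ k)) :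
  (0 < k)%N -> hurwitz M ->
  exists! w : 'cV[R]_(n ^ k), recast ((lyapunov k M)^T *m w) = rhs.
Proof.
move=> k0 hM.
have recast_lyapunov w : recast ((lyapunov k M)^T *m w) = (kron_sum k M)^T *m w.
  rewrite (recastE _ (dim_lhs n k0) erefl) lyapunov_kron_sum trmx_cast castmx_mul /=.
  by rewrite castmx_comp /= !castmx_id.
have unitL : (kron_sum k M)^T \in unitmx by rewrite unitmx_tr hurwitz_kron_sum_unit.
exists (invmx (kron_sum k M)^T *m rhs); split; first by rewrite recast_lyapunov mulKVmx.
by move=> w; rewrite recast_lyapunov => <-; rewrite mulKmx.
Qed.

Theorem theorem4 (R : realType) (n m ell d : nat) (lam : int)
  (n_ge1 : (1 <= n)%N) (m_ge1 : (1 <= m)%N) (ell_ge1 : (1 <= ell)%N) (d_ge2 : (2 <= d)%N)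
  (A : 'M[R]_n) (F : forall p, 'M[R]_(n, n ^ p))
  (B : 'M[R]_(n, m)) (G : forall p, 'M[R]_(n, n ^ p * m))
  (Q : 'M[R]_n) (Rm : 'M[R]_m) (q : forall p, 'cV[R]_(n ^ p))
  (Q_sym : symmetric_mx Q) (Q_psd : possemidef Q)
  (Rm_sym : symmetric_mx Rm) (Rm_pd : posdef Rm)
  (penalty_psd : exists QQ : 'cV[R]_n -> 'M[R]_n, forall x,
     [/\ symmetric_mx (QQ x), possemidef (QQ x) &
         state_penalty lam Q q x = (x^T *m QQ x *m x) 0 0])
  (f_analytic : analytic_mx (drift ell A F))
  (g_analytic : analytic_mx (input_map ell B G))
  (state_penalty_analytic : analytic (state_penalty lam Q q))
  (input_penalty_analytic : analytic (input_penalty Rm))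
  (V2 : 'M[R]_n) (V2_lqr : lqr_stabilizing_solution A B Q Rm V2) :
  forall k, (3 <= k <= d)%N ->
  forall vt v : (forall i, 'cV[R]_(n ^ i)),
    coefs_below ell lam A F B G Rm q V2 k vt v ->
    exists! w : 'cV[R]_(n ^ k), coef_system ell lam A F B G Rm q V2 v w.
Proof.
move=> k /andP[k3 _] vt v _; have [_ _ _ hurwitzM _] := V2_lqr.
by apply: hurwitz_lyapunov_system => //; apply: leq_trans k3.
Qed.
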